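(* The map $\delta^{\mathrm{dif}}:\mathcal{H}^{\mathrm{inv}}\to\mathcal{H}^{\mathrm{inv}}\otimes\mathcal{H}^{\mathrm{dif}}$ is a co-action with respect to $\Delta^{\mathrm{dif}}$, that is, $$(\delta^{\mathrm{dif}}\otimes\mathrm{Id})\,\delta^{\mathrm{dif}}=(\mathrm{Id}\otimes\Delta^{\mathrm{dif}})\,\delta^{\mathrm{dif}}.$$
   Context: $\mathcal{H}^{\mathrm{dif}}=\mathbb{C}\langle a_1,a_2,\dots\rangle$ and $\mathcal{H}^{\mathrm{inv}}=\mathbb{C}\langle b_1,b_2,\dots\rangle$ are free associative unital $\mathbb{C}$-algebras; put $a_0:=1$, $b_0:=1$, $A(x)=\sum_{n\ge0}a_nx^{n+1}$, $B(x)=\sum_{n\ge0}b_nx^n$, where power series variables commute with everything. The expression $\frac1{z-A(x)}$ is expanded as $\sum_{k\ge0}A(x)^kz^{-k-1}$, and $\langle z^{-1}\rangle F(z)$ denotes the coefficient of $z^{-1}$ in $F(z)$. The co-product $\Delta^{\mathrm{dif}}:\mathcal{H}^{\mathrm{dif}}\to\mathcal{H}^{\mathrm{dif}}\otimes\mathcal{H}^{\mathrm{dif}}$ is the unital algebra homomorphism given on generators by $\Delta^{\mathrm{dif}}A(x):=\sum_{n\ge0}\Delta^{\mathrm{dif}}(a_n)x^{n+1}=\langle z^{-1}\rangle A(z)\otimes\frac1{z-A(x)}$. The map $\delta^{\mathrm{dif}}:\mathcal{H}^{\mathrm{inv}}\to\mathcal{H}^{\mathrm{inv}}\otimes\mathcal{H}^{\mathrm{dif}}$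 is the unital algebra homomorphism given on generators by $\delta^{\mathrm{dif}}B(x):=\sum_{n\ge0}\delta^{\mathrm{dif}}(b_n)x^n=\langle z^{-1}\rangle B(z)\otimes\frac1{z-A(x)}$. *)

(* Defs.v *)
From HB Require Import structures.
From mathcomp Require Import all_boot all_order all_algebra finmap.
From mathcomp Require Import monalg.

Set Implicit Arguments.
Unset Strict Implicit.
Unset Printing Implicit Defensive.

Import GRing.Theory.

Local Open Scope ring_scope.

Section LinearExtension.
Context {K : comNzRingType} {M : choiceType} {V : lmodType K}.
Variable h : M -> V.

Definition linext (u : {malg K[M]}) : V := \sum_(m <- msupp u) u@_m *: h m.

Lemma linextEw (d : {fset M}) u :
  (msupp u `<=` d)%fset -> linext u = \sum_(m <- d) u@_m *: h m.
Proof.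
move=> le; rewrite [LHS](big_fset_incl _ le) => //= x _ /mcoeff_outdom ->.
by rewrite scale0r.
Qed.

Lemma linext_is_linear : linear linext.
Proof.
move=> c u v; set E := (msupp u `|` msupp v)%fset.
have leu : (msupp u `<=` E)%fset by exact: fsubsetUl.
have lev : (msupp v `<=` E)%fset by exact: fsubsetUr.
have le : (msupp (c *: u + v) `<=` E)%fset.
  apply: (fsubset_trans (msuppD_le _ _)).
  by apply: fsetUSS => //; apply: msuppZ_le.
rewrite (linextEw le) (linextEw leu) (linextEw lev) scaler_sumr -big_split /=.
by apply: eq_bigr => m _; rewrite mcoeffD mcoeffZ scalerDl scalerA.
Qed.

HB.instance Definition _ :=
  GRing.isLinear.Build K {malg K[M]} V *:%R linext linext_is_linear.

Lemma linextU m : linext << m >> = h m.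
Proof. by rewrite (linextEw msuppU_le) big_seq_fset1 mcoeffUU scale1r. Qed.

End LinearExtension.

Lemma malg_basisE (K : comNzRingType) (M : choiceType) (u : {malg K[M]}) :
  u = \sum_(m <- msupp u) u@_m *: << m >>.
Proof.
rewrite [LHS]monalgE; apply: eq_bigr => m _; apply/malgP=> k.
by rewrite mcoeffZ !mcoeffU mulr_natr.
Qed.

Lemma linear_malg_ext (K : comNzRingType) (M : choiceType) (V : lmodType K)
    (f g : {linear {malg K[M]} -> V}) :
  (forall m, f << m >> = g << m >>) -> f =1 g.
Proof.
move=> fg u; rewrite (malg_basisE u) !linear_sum.
by apply: eq_bigr => m _; rewrite !linearZ /= fg.
Qed.

Lemma malg_linear_ind (K : comNzRingType) (M : choiceType)
    (P : {malg K[M]} -> Prop) :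
  P 0 -> (forall c m u, P u -> P (c *: << m >> + u)) -> forall u, P u.
Proof.
move=> P0 PD u; rewrite (malg_basisE u).
elim: (msupp u : seq _) => [|m s IHs]; first by rewrite big_nil.
by rewrite big_cons; apply: PD.
Qed.

Lemma malgUM (K : comNzRingType) (M : monomType) (m n : M) :
  << m >> * << n >> = << mmul m n >> :> {malg K[M]}.
Proof. by have := fgmulUU (1 : K) 1 m n; rewrite mulr1. Qed.

Lemma malg_scaleAr (K : comNzRingType) (M : monomType) (c : K)
    (u v : {malg K[M]}) : c *: (u * v) = u * (c *: v).
Proof.
rewrite -!mul_malgC !mulrA; congr (_ * _).
rewrite !malgM_def fgmulUg fgmulgU; apply: eq_bigr => m _.
by rewrite mul1m mulm1 mulrC.
Qed.

Section ProductMonoid.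
Context (M N : monomType).

Definition pmone : M * N := (mone, mone).
Definition pmmul (p q : M * N) : M * N := (mmul p.1 q.1, mmul p.2 q.2).

Lemma pmmulA : associative pmmul.
Proof. by move=> p q r; rewrite /pmmul !mulmA. Qed.

Lemma pmmul1m : left_id pmone pmmul.
Proof. by case=> m n; rewrite /pmmul !mul1m. Qed.

Lemma pmmulm1 : right_id pmone pmmul.
Proof. by case=> m n; rewrite /pmmul !mulm1. Qed.

Lemma pmmul_eq1 p q : pmmul p q = pmone -> p = pmone /\ q = pmone.
Proof.
by case: p q => [m n] [m' n'] [/unitm[/= -> ->] /unitm[/= -> ->]].
Qed.

HB.instance Definition _ := Choice_isMonomialDef.Build (M * N)%type
  pmmulA pmmul1m pmmulm1 pmmul_eq1.

End ProductMonoid.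

(* The tensor product over K of the free modules {malg K[M]} and {malg K[N]} is
   realised as {malg K[(M * N)%type]}, the pure tensor of the basis elements
   << m >> and << n >> being << (m, n) >>.  Its universal property is given by
   tens_liftE and tens_ext, and the algebra structure carried by the product
   monoid is the usual one by tens1 and tensM. *)
Section Tensor.
Context {K : comNzRingType} {M N : choiceType}.
Implicit Types (u : {malg K[M]}) (v : {malg K[N]}).

Definition tens u v : {malg K[(M * N)%type]} :=
  \sum_(m <- msupp u) \sum_(n <- msupp v) << u@_m * v@_n *g (m, n) >>.

Lemma mcoeff_tens u v m n : (tens u v)@_(m, n) = u@_m * v@_n.
Proof.
have -> : tens u v =
    \sum_(m <- (m |` msupp u)%fset) \sum_(n <- (n |` msupp v)%fset)
       << u@_m * v@_n *g (m, n) >>.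
  rewrite /tens (big_fset_incl _ (fsubsetU1 m _)) /=.
    apply: eq_bigr => i _; apply: big_fset_incl; first exact: fsubsetU1.
    by move=> j _ /mcoeff_outdom ->; rewrite mulr0 monalgU0.
  move=> i _ /mcoeff_outdom ui0; rewrite big1 // => j _.
  by rewrite ui0 mul0r monalgU0.
rewrite (big_fsetD1 m) /= ?fset1U1 // (big_fsetD1 n) /= ?fset1U1 //.
rewrite !mcoeffD mcoeffUU !raddf_sum !big_seq !big1 ?addr0 //= => i.
  rewrite !in_fsetD1 => /andP[im _]; rewrite raddf_sum big1 //= => j _.
  by rewrite mcoeffU xpair_eqE (negbTE im).
rewrite !in_fsetD1 => /andP[im _].
by rewrite mcoeffU xpair_eqE (negbTE im) andbF.
Qed.

Lemma tens_linearl v : linear (tens^~ v).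
Proof.
move=> c u u'; apply/malgP=> -[m n].
by rewrite mcoeffD mcoeffZ !mcoeff_tens mcoeffD mcoeffZ mulrDl mulrA.
Qed.

Lemma tens_linearr u : linear (tens u).
Proof.
move=> c v v'; apply/malgP=> -[m n].
by rewrite mcoeffD mcoeffZ !mcoeff_tens mcoeffD mcoeffZ mulrDr mulrCA.
Qed.

HB.instance Definition _ u := GRing.isLinear.Build K {malg K[N]}
  {malg K[(M * N)%type]} *:%R (tens u) (tens_linearr u).

Lemma tensU m n : tens << m >> << n >> = << (m, n) >>.
Proof.
apply/malgP=> -[i j]; rewrite mcoeff_tens !mcoeffU xpair_eqE.
by case: eqP; case: eqP => _ _; rewrite ?mulr0 ?mul0r ?mulr1.
Qed.

Definition tens_lift {V : lmodType K} (beta : {malg K[M]} -> {malg K[N]} -> V) :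
    {malg K[(M * N)%type]} -> V :=
  linext (fun k : M * N => beta << k.1 >> << k.2 >>).

HB.instance Definition _ (V : lmodType K) beta :=
  GRing.Linear.copy (@tens_lift V beta)
    (linext (fun k : M * N => beta << k.1 >> << k.2 >>)).

Lemma tens_liftE (V : lmodType K) (beta : {malg K[M]} -> {malg K[N]} -> V) :
  (forall v, linear (beta^~ v)) -> (forall u, linear (beta u)) ->
  forall u v, tens_lift beta (tens u v) = beta u v.
Proof.
move=> linl linr u v.
pose Lr u' := HB.pack_for {linear {malg K[N]} -> V} (beta u')
  (GRing.isLinear.Build K {malg K[N]} V *:%R (beta u') (linr u')).
pose Ll v' := HB.pack_for {linear {malg K[M]} -> V} (beta^~ v')
  (GRing.isLinear.Build K {malg K[M]} V *:%R (beta^~ v') (linl v')).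
pose Tl v' := HB.pack_for {linear {malg K[M]} -> {malg K[(M * N)%type]}}
  (tens^~ v') (GRing.isLinear.Build K {malg K[M]} {malg K[(M * N)%type]} *:%R
  (tens^~ v') (tens_linearl v')).
apply: (linear_malg_ext (f := tens_lift beta \o tens u) (g := Lr u)) => n /=.
apply: (linear_malg_ext (f := tens_lift beta \o Tl << n >>)
  (g := Ll << n >>)) => m /=.
by rewrite tensU /tens_lift linextU.
Qed.

Lemma tens_ext (V : lmodType K) (f g : {linear {malg K[(M * N)%type]} -> V}) :
  (forall u v, f (tens u v) = g (tens u v)) -> f =1 g.
Proof. by move=> fg; apply: linear_malg_ext => -[m n]; rewrite -tensU fg. Qed.

End Tensor.

Notation "u ⊗ v" := (tens u v) (at level 40, left associativity) : ring_scope.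

Section TensorAlgebra.
Context {K : comNzRingType} {M N : monomType}.

Lemma tens1 : (1 : {malg K[M]}) ⊗ (1 : {malg K[N]}) = 1.
Proof. exact: tensU. Qed.

Lemma tensM (u u' : {malg K[M]}) (v v' : {malg K[N]}) :
  (u ⊗ v) * (u' ⊗ v') = (u * u') ⊗ (v * v').
Proof.
have T0 (x : {malg K[M]}) : x ⊗ (0 : {malg K[N]}) = 0 by exact: linear0.
have T0l (x : {malg K[N]}) : (0 : {malg K[M]}) ⊗ x = 0.
  by apply/malgP=> -[i j]; rewrite mcoeff_tens !mcoeff0 mul0r.
elim/malg_linear_ind: u => [|a m u IHu]; first by rewrite !(T0l, mul0r).
rewrite mulrDl tens_linearl mulrDl IHu -[a *: _ * u']scalerAl tens_linearl.
rewrite -[a *: _ * (u' ⊗ v')]scalerAl.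
suff -> : (<< m >> ⊗ v) * (u' ⊗ v') = (<< m >> * u') ⊗ (v * v') by [].
elim/malg_linear_ind: v {IHu} => [|b n v IHv]; first by rewrite !(T0, mul0r).
rewrite mulrDl tens_linearr mulrDl IHv -[b *: _ * v']scalerAl tens_linearr.
rewrite -[b *: _ * (u' ⊗ v')]scalerAl.
suff -> : (<< m >> ⊗ << n >>) * (u' ⊗ v') = (<< m >> * u') ⊗ (<< n >> * v')
  by [].
elim/malg_linear_ind: u' {IHv} => [|a' m' u' IHu].
  by rewrite !(T0l, mulr0).
rewrite mulrDr tens_linearl mulrDr IHu -[_ * (a' *: << _ >>)]malg_scaleAr.
rewrite tens_linearl -[_ * (a' *: (_ ⊗ _))]malg_scaleAr.
suff -> : (<< m >> ⊗ << n >>) * (<< m' >> ⊗ v')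
    = (<< m >> * << m' >>) ⊗ (<< n >> * v') by [].
elim/malg_linear_ind: v' {IHu} => [|b' n' v' IHv].
  by rewrite !(T0, mulr0).
rewrite mulrDr tens_linearr mulrDr IHv -[_ * (b' *: << _ >>)]malg_scaleAr.
rewrite tens_linearr -[_ * (b' *: (_ ⊗ _))]malg_scaleAr.
suff -> : (<< m >> ⊗ << n >>) * (<< m' >> ⊗ << n' >>)
    = (<< m >> * << m' >>) ⊗ (<< n >> * << n' >>)
    :> {malg K[(M * N)%type]} by [].
by rewrite !tensU !malgUM tensU.
Qed.

End TensorAlgebra.

Section TensorMaps.
Context {K : comNzRingType}.

Definition tens_map {M N M' N' : choiceType}
    (f : {malg K[M]} -> {malg K[M']}) (g : {malg K[N]} -> {malg K[N']}) :
    {malg K[(M * N)%type]} -> {malg K[(M' * N')%type]} :=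
  tens_lift (fun u v => f u ⊗ g v).

Lemma tens_mapE (M N M' N' : choiceType)
    (f : {linear {malg K[M]} -> {malg K[M']}})
    (g : {linear {malg K[N]} -> {malg K[N']}}) u v :
  tens_map f g (u ⊗ v) = f u ⊗ g v.
Proof.
apply: (tens_liftE (beta := fun u v => f u ⊗ g v)) => [w c x y|w c x y].
  by rewrite linearP tens_linearl.
by rewrite linearP tens_linearr.
Qed.

Definition tens_assoc {M N P : choiceType} :
    {malg K[(M * N * P)%type]} -> {malg K[(M * (N * P))%type]} :=
  tens_lift (fun t w => tens_lift (fun u v => u ⊗ (v ⊗ w)) t).

Lemma tens_assocE (M N P : choiceType)
    (u : {malg K[M]}) (v : {malg K[N]}) (w : {malg K[P]}) :
  tens_assoc (u ⊗ v ⊗ w) = u ⊗ (v ⊗ w).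
Proof.
have inner w' t v' :
    tens_lift (fun (u : {malg K[M]}) (v : {malg K[N]}) => u ⊗ (v ⊗ w'))
      (t ⊗ v') = t ⊗ (v' ⊗ w').
  apply: (tens_liftE (beta := fun u v => u ⊗ (v ⊗ w'))) => [y|y] c x z.
    by rewrite tens_linearl.
  by rewrite tens_linearl tens_linearr.
rewrite /tens_assoc (tens_liftE (beta := fun t w => tens_lift _ t)) ?inner //.
  by move=> w'; exact: linearP.
move=> t c w1 w2; rewrite /tens_lift /linext scaler_sumr -big_split /=.
apply: eq_bigr => k _; rewrite tens_linearr tens_linearr scalerDr scalerA.
by rewrite mulrC -scalerA.
Qed.

End TensorMaps.

Section FreeAlgebra.
Context {K : comNzRingType} {I : choiceType}.

Definition free_gen (i : I) : {malg K[{fmonom I}]} := << fmu i >>.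

Context {N : monomType}.
Variable h : I -> {malg K[N]}.

Definition free_lift : {malg K[{fmonom I}]} -> {malg K[N]} :=
  linext (fun w : {fmonom I} => \prod_(i <- w) h i).

HB.instance Definition _ := GRing.Linear.copy free_lift
  (linext (fun w : {fmonom I} => \prod_(i <- w) h i)).

Lemma free_lift_is_monoid_morphism : monoid_morphism free_lift.
Proof.
split=> [|u v]; first by rewrite /free_lift linextU fm1 big_nil.
elim/malg_linear_ind: u => [|a m u IHu]; first by rewrite !(mul0r, linear0).
rewrite mulrDl -[a *: _ * v]scalerAl [LHS]linearP /= IHu.
rewrite [free_lift (_ + u)]linearP /= mulrDl -[a *: _ * free_lift v]scalerAl.
suff -> : free_lift (<< m >> * v) = free_lift << m >> * free_lift v by [].
elim/malg_linear_ind: v {IHu} => [|b n v IHv].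
  by rewrite !(mulr0, linear0).
rewrite mulrDr -[_ * (b *: _)]malg_scaleAr [LHS]linearP /= IHv.
rewrite [free_lift (_ + v)]linearP /= mulrDr.
rewrite -[_ * (b *: free_lift _)]malg_scaleAr.
suff -> : free_lift (<< m >> * << n >>) = free_lift << m >> * free_lift << n >>
  by [].
by rewrite malgUM /free_lift !linextU fmM big_cat.
Qed.

HB.instance Definition _ :=
  GRing.isMonoidMorphism.Build {malg K[{fmonom I}]} {malg K[N]}
  free_lift free_lift_is_monoid_morphism.

Lemma free_lift_gen i : free_lift (free_gen i) = h i.
Proof. by rewrite /free_lift linextU fmU big_seq1. Qed.

Lemma free_ext (f g : {lrmorphism {malg K[{fmonom I}]} -> {malg K[N]}}) :
  (forall i, f (free_gen i) = g (free_gen i)) -> f =1 g.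
Proof.
move=> fg; apply: linear_malg_ext => -[s]; rewrite -fmE.
elim: s => [|i s IHs]; first by rewrite [<< _ >>](_ : _ = 1) ?rmorph1.
have -> : << fmonom_of_seq fmonom_key (i :: s) >>
    = free_gen i * << fmonom_of_seq fmonom_key s >> :> {malg K[{fmonom I}]}.
  rewrite malgUM; congr << _ >>.
  by apply/eqP; rewrite fmP fmM fmU !fmE.
by rewrite !rmorphM /= fg IHs.
Qed.

End FreeAlgebra.

(* A formal power series in a central variable is its coefficient sequence. *)
Section PowerSeries.
Context {S : nzRingType}.
Implicit Types A : nat -> S.

Definition ps_one : nat -> S := fun n => (n == 0%N)%:R.

Definition ps_mul (A A' : nat -> S) : nat -> S :=
  fun n => \sum_(i < n.+1) A i * A' (n - i)%N.

Definition ps_exp A (k : nat) : nat -> S := iter k (ps_mul A) ps_one.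

(* resolvent A e n is the coefficient of z^e x^n in 1/(z - A(x)), expanded as
   the sum over k of A(x)^k z^(-k-1); note that Negz k is - k.+1. *)
Definition resolvent A (e : int) (n : nat) : S :=
  if e is Negz k then ps_exp A k n else 0.

Lemma ps_exp_lt A k n : A 0%N = 0 -> (n < k)%N -> ps_exp A k n = 0.
Proof.
move=> A0; elim: k n => // k IHk n lt_nk.
rewrite /ps_exp iterS -/(ps_exp A k) /ps_mul big1 // => -[[|i] lti] _ /=.
  by rewrite A0 mul0r.
rewrite IHk ?mulr0 //; case: n lti lt_nk => // n _.
by rewrite subSS ltnS; apply/leq_ltn_trans/leq_subr.
Qed.

Lemma ps_exp1 A n : ps_exp A 1 n = A n.
Proof.
rewrite /ps_exp /= /ps_mul big_ord_recr /= subnn mulr1 big1 ?add0r // => i _.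
by rewrite /ps_one subn_eq0 leqNgt ltn_ord mulr0.
Qed.

Lemma resolvent_lt A m n :
  A 0%N = 0 -> (n < m)%N -> resolvent A (-1 - m%:Z) n = 0.
Proof. by move=> A0 ltnm; rewrite -opprD -NegzE /= ps_exp_lt. Qed.

End PowerSeries.

(* The coefficient of x^n in <z^{-1}> F(z) ⊗ 1/(z - A(x)), for A(0) = 0.  By
   resolvent_lt the terms with m > n of the sum over m vanish. *)
Definition residue {K : comNzRingType} {M N : monomType}
    (F : nat -> {malg K[M]}) (A : nat -> {malg K[N]}) (n : nat) :
    {malg K[(M * N)%type]} :=
  \sum_(m < n.+1) F m ⊗ resolvent A (-1 - m%:Z) n.

Lemma residueE (K : comNzRingType) (M N : monomType)
    (F : nat -> {malg K[M]}) (A : nat -> {malg K[N]}) (n : nat) :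
  residue F A n = \sum_(m < n.+1) F m ⊗ ps_exp A m n.
Proof. by apply: eq_bigr => m _; rewrite -opprD -NegzE. Qed.

(* H^dif and H^inv are two copies of the free algebra on countably many
   generators; the generator of index i stands for a_{i+1}, resp. b_{i+1}. *)
Notation Hdif K := {malg K[{fmonom nat}]}.
Notation Hinv K := {malg K[{fmonom nat}]}.

Section Coaction.
Variable K : comNzRingType.

Definition gen_a (n : nat) : Hdif K := if n is i.+1 then free_gen i else 1.
Definition gen_b (n : nat) : Hinv K := if n is i.+1 then free_gen i else 1.

Definition ser_A (n : nat) : Hdif K := if n is i.+1 then gen_a i else 0.
Definition ser_B (n : nat) : Hinv K := gen_b n.

Definition Delta_dif : Hdif K -> {malg K[({fmonom nat} * {fmonom nat})%type]} :=
  free_lift (fun i => residue ser_A ser_A i.+2).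

Definition delta_dif : Hinv K -> {malg K[({fmonom nat} * {fmonom nat})%type]} :=
  free_lift (fun i => residue ser_B ser_A i.+1).

HB.instance Definition _ := GRing.LRMorphism.copy Delta_dif
  (free_lift (fun i => residue ser_A ser_A i.+2)).
HB.instance Definition _ := GRing.LRMorphism.copy delta_dif
  (free_lift (fun i => residue ser_B ser_A i.+1)).

(* The equation Delta A(x) = <z^{-1}> A(z) ⊗ 1/(z - A(x)), coefficientwise. *)
Lemma residue_AA0 : residue ser_A ser_A 0 = 0.
Proof.
rewrite residueE big_ord1; apply/malgP=> -[m n].
by rewrite mcoeff_tens !mcoeff0 mul0r.
Qed.

Lemma Delta_difE n : Delta_dif (gen_a n) = residue ser_A ser_A n.+1.
Proof.
case: n => [|n]; last by rewrite /Delta_dif free_lift_gen.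
rewrite rmorph1 residueE big_ord_recl big_ord1.
rewrite [ps_exp _ (lift _ _) _]ps_exp1 tens1.
rewrite [X in X + _](_ : _ = 0) ?add0r //.
by apply/malgP=> -[m n]; rewrite mcoeff_tens !mcoeff0 mul0r.
Qed.

(* The equation delta B(x) = <z^{-1}> B(z) ⊗ 1/(z - A(x)), coefficientwise. *)
Lemma delta_difE n : delta_dif (gen_b n) = residue ser_B ser_A n.
Proof.
case: n => [|n]; last by rewrite /delta_dif free_lift_gen.
by rewrite rmorph1 residueE big_ord1 /= tens1.
Qed.

End Coaction.

Arguments gen_a {K} n.
Arguments gen_b {K} n.
Arguments ser_A {K} n.
Arguments ser_B {K} n.
Arguments Delta_dif {K} _.
Arguments delta_dif {K} _.

(* Main.v *)
Require Import Defs.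
From HB Require Import structures.
From mathcomp Require Import all_boot all_order all_algebra.
From mathcomp Require Import reals complex monalg.

Set Implicit Arguments.
Unset Strict Implicit.
Unset Printing Implicit Defensive.

Import GRing.Theory.

Local Open Scope ring_scope.

(** Write [A^m]_n for the coefficient of x^n in A(x)^m.  On generators
    delta(b_n) is the sum over m of b_m ⊗ [A^m]_n, so both iterates send b_n to
    a sum over l of b_l ⊗ (...), and the co-action identity amounts to the
    formula Delta([A^l]_n) = sum over m of [A^l]_m ⊗ [A^m]_n, that is,
    Delta(A^l) = residue of A^l against A.

    The formula holds because substituting A(x) for z, i.e. the map taking F(z)
    to <z^{-1}> F(z) ⊗ 1/(z - A(x)), is multiplicative in F even though A has
    non-commuting coefficients: the coefficients of F and those of A sit in
    different tensor factors, hence commute, and A^p A^q = A^(p+q)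
    (residue_mul).  Thus both Delta, applied coefficientwise, and the
    substitution send A^l to the l-th power of Delta(A).

    Both sides of the co-action identity are algebra morphisms on a free
    algebra, so the check on generators suffices. *)

(** * Tensor products of algebra morphisms *)

Section TensorMorphisms.
Context {K : comNzRingType}.

Lemma tens_suml (M N : choiceType) (J : Type) (s : seq J) (P : pred J)
    (F : J -> {malg K[M]}) (v : {malg K[N]}) :
  (\sum_(j <- s | P j) F j) ⊗ v = \sum_(j <- s | P j) (F j ⊗ v).
Proof.
pose f := HB.pack_for {linear {malg K[M]} -> {malg K[(M * N)%type]}}
  (fun u : {malg K[M]} => u ⊗ v) (GRing.isLinear.Build K {malg K[M]}
  {malg K[(M * N)%type]} *:%R (fun u : {malg K[M]} => u ⊗ v) (tens_linearl v)).
exact: (linear_sum f).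
Qed.

Lemma tens_sumr (M N : choiceType) (J : Type) (s : seq J) (P : pred J)
    (u : {malg K[M]}) (F : J -> {malg K[N]}) :
  u ⊗ (\sum_(j <- s | P j) F j) = \sum_(j <- s | P j) (u ⊗ F j).
Proof. exact: linear_sum. Qed.

Lemma tens0r (M N : choiceType) (u : {malg K[M]}) :
  u ⊗ (0 : {malg K[N]}) = 0.
Proof. exact: linear0. Qed.

Lemma linear_multiplicative (M N : monomType)
    (f : {linear {malg K[M]} -> {malg K[N]}}) :
  (forall m n, f (<< m >> * << n >>) = f << m >> * f << n >>) ->
  {morph f : u v / u * v}.
Proof.
move=> fM u v; elim/malg_linear_ind: u => [|a m u IHu].
  by rewrite mul0r linear0 mul0r.
rewrite mulrDl -scalerAl !linearP IHu mulrDl -scalerAl.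
congr (a *: _ + _).
elim/malg_linear_ind: v {IHu} => [|b n v IHv].
  by rewrite mulr0 linear0 mulr0.
by rewrite mulrDr -malg_scaleAr !linearP IHv mulrDr -malg_scaleAr fM.
Qed.

HB.instance Definition _ (M N M' N' : choiceType)
    (f : {malg K[M]} -> {malg K[M']}) (g : {malg K[N]} -> {malg K[N']}) :=
  GRing.Linear.copy (tens_map f g) (tens_lift (fun u v => f u ⊗ g v)).

HB.instance Definition _ (M N P : choiceType) :=
  GRing.Linear.copy (@tens_assoc K M N P)
    (tens_lift (fun t w => tens_lift (fun u v => u ⊗ (v ⊗ w)) t)).

Lemma tens_map_monoid_morphism (M N M' N' : monomType)
    (f : {lrmorphism {malg K[M]} -> {malg K[M']}})
    (g : {lrmorphism {malg K[N]} -> {malg K[N']}}) :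
  monoid_morphism (tens_map f g).
Proof.
split; first by rewrite -tens1 tens_mapE !rmorph1 tens1.
apply: linear_multiplicative => -[m n] [m' n'] /=.
by rewrite -!tensU tensM !tens_mapE tensM !rmorphM.
Qed.

HB.instance Definition _ (M N M' N' : monomType)
    (f : {lrmorphism {malg K[M]} -> {malg K[M']}})
    (g : {lrmorphism {malg K[N]} -> {malg K[N']}}) :=
  GRing.isMonoidMorphism.Build {malg K[(M * N)%type]} {malg K[(M' * N')%type]}
    (tens_map f g) (tens_map_monoid_morphism f g).

Lemma tens_assoc_monoid_morphism (M N P : monomType) :
  monoid_morphism (@tens_assoc K M N P).
Proof.
split; first by rewrite -!tens1 tens_assocE.
apply: linear_multiplicative => -[[m n] p] [[m' n'] p'] /=.
by rewrite -!tensU !tensM !tens_assocE !tensM.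
Qed.

HB.instance Definition _ (M N P : monomType) :=
  GRing.isMonoidMorphism.Build {malg K[(M * N * P)%type]}
    {malg K[(M * (N * P))%type]}
    (@tens_assoc K M N P) (tens_assoc_monoid_morphism M N P).

End TensorMorphisms.

(** * Power series with non-commuting coefficients *)

Section PowerSeriesTheory.
Context {S : nzRingType}.
Implicit Types A B C : nat -> S.

Lemma eq_ps_mul A A' B B' : A =1 A' -> B =1 B' -> ps_mul A B =1 ps_mul A' B'.
Proof. by move=> eA eB n; apply: eq_bigr => i _; rewrite eA eB. Qed.

(** Truncation to polynomials turns identities between series into identities
    between polynomials. *)
Lemma ps_mul_poly N A B n : (n < N)%N ->
  (\poly_(i < N) A i * \poly_(i < N) B i)`_n = ps_mul A B n.
Proof.
move=> ltnN; rewrite coefM; apply: eq_bigr => -[i /= lt_in] _.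
rewrite !coef_poly (leq_ltn_trans _ ltnN) //.
by rewrite (leq_ltn_trans (leq_subr _ _) ltnN).
Qed.

Lemma ps_mulA A B C : ps_mul A (ps_mul B C) =1 ps_mul (ps_mul A B) C.
Proof.
move=> n; pose p (D : nat -> S) := \poly_(i < n.+1) D i.
transitivity (p A * (p B * p C))`_n.
  rewrite coefM; apply: eq_bigr => -[i /= lt_in] _.
  by rewrite ps_mul_poly ?ltnS ?leq_subr // coef_poly lt_in.
rewrite mulrA coefM; apply: eq_bigr => -[i /= lt_in] _.
by rewrite ps_mul_poly // coef_poly ltnS leq_subr.
Qed.

Lemma ps_mul1l A : ps_mul ps_one A =1 A.
Proof.
move=> n; rewrite /ps_mul big_ord_recl /= subn0 /ps_one eqxx mul1r.
by rewrite big1 ?addr0 // => i _; rewrite mul0r.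
Qed.

Lemma ps_expS A k : ps_exp A k.+1 = ps_mul A (ps_exp A k).
Proof. by []. Qed.

Lemma ps_expD A p q : ps_exp A (p + q) =1 ps_mul (ps_exp A p) (ps_exp A q).
Proof.
elim: p => [|p IHp] n; first by rewrite add0n ps_mul1l.
by rewrite addSn !ps_expS -ps_mulA; apply: eq_ps_mul.
Qed.

Lemma eq_ps_exp A A' k : A =1 A' -> ps_exp A k =1 ps_exp A' k.
Proof. by move=> eA; elim: k => //= k IHk; apply: eq_ps_mul. Qed.

Lemma rmorph_ps_exp (S' : nzRingType) (f : {rmorphism S -> S'}) A k n :
  f (ps_exp A k n) = ps_exp (f \o A) k n.
Proof.
elim: k n => [|k IHk] n; first by rewrite /= /ps_one rmorph_nat.
rewrite !ps_expS rmorph_sum; apply: eq_bigr => i _.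
by rewrite rmorphM IHk.
Qed.

End PowerSeriesTheory.

(** * Substitution of a series in the second tensor factor *)

(** Regrouping a double sum along its antidiagonals: those beyond the n-th
    contribute nothing, so the square may replace the triangle. *)
Lemma sum_triangle (V : nmodType) (n : nat) (f : nat -> nat -> V) :
  (forall p q, (n < p + q)%N -> f p q = 0) ->
  \sum_(m < n.+1) \sum_(p < m.+1) f p (m - p)%N
  = \sum_(p < n.+1) \sum_(q < n.+1) f p q.
Proof.
move=> f0.
transitivity
  (\sum_(m < n.+1) \sum_(p < n.+1 | (p < m.+1)%N) f p (m - p)%N).
  apply: eq_bigr => m _.
  exact: (big_ord_widen n.+1 (fun p => f p (m - p)%N)).
rewrite (exchange_big_dep xpredT) //=; apply: eq_bigr => -[p /= ltp] _.
rewrite -(big_mkord (fun m => p < m.+1)%N (fun m => f p (m - p)%N)).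
rewrite -(big_mkord xpredT (f p)).
(* Column p of the triangle starts at m = p; shift it to start at q = 0. *)
rewrite (big_cat_nat (leq0n p) (ltnW ltp)) /=.
rewrite big_nat_cond big1 ?add0r; last first.
  by move=> i /andP[/andP[_ ltip]]; rewrite ltnS leqNgt ltip.
rewrite (big_cat_nat (leq0n (n.+1 - p)%N) (leq_subr _ _)) /=.
rewrite [X in _ = _ + X]big_nat_cond [X in _ = _ + X]big1 ?addr0; last first.
  move=> q /andP[/andP[leq_q _] _]; apply: f0.
  by rewrite -leq_subLR.
rewrite -{1}[p]add0n big_addn big_nat_cond [RHS]big_nat_cond.
by apply: eq_big => [q|q _]; rewrite ?addnK // ltnS leq_addl.
Qed.

Section Residue.
Context {K : comNzRingType} {M N : monomType}.
Variable A : nat -> {malg K[N]}.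
Hypothesis A0 : A 0%N = 0.
Implicit Types F G : nat -> {malg K[M]}.

(** As A(0) = 0, the series A^p starts at x^p; a summation range common to all
    coefficients makes it possible to exchange sums. *)
Lemma residue_widen n m F : (m <= n)%N ->
  residue F A m = \sum_(p < n.+1) F p ⊗ ps_exp A p m.
Proof.
move=> lemn; rewrite residueE.
rewrite (big_ord_widen n.+1 (fun p => F p ⊗ ps_exp A p m)) //.
rewrite big_mkcond; apply: eq_bigr => p _.
by rewrite ltnS; case: leqP => // ltmp; rewrite ps_exp_lt ?tens0r.
Qed.

Lemma residue_one : residue (ps_one : nat -> {malg K[M]}) A =1 ps_one.
Proof.
move=> n; rewrite residueE big_ord_recl big1 ?addr0 => [|i _]; last first.
  by apply/malgP=> -[m k]; rewrite mcoeff_tens !mcoeff0 mul0r.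
rewrite /= /ps_one eqxx; case: n => [|n]; first by rewrite /= tens1.
by rewrite /= tens0r.
Qed.

(** The coefficients of F and G commute with those of A, being in the other
    tensor factor, so the powers of A coming from F and from G can be brought
    together: A^p A^q = A^(p+q). *)
Lemma residue_mul F G :
  residue (ps_mul F G) A =1 ps_mul (residue F A) (residue G A).
Proof.
move=> n; pose f p q := (F p * G q) ⊗ ps_exp A (p + q) n.
transitivity (\sum_(p < n.+1) \sum_(q < n.+1) f p q).
  rewrite -sum_triangle => [|p q ltn]; last by rewrite /f ps_exp_lt ?tens0r.
  rewrite residueE; apply: eq_bigr => m _; rewrite tens_suml.
  by apply: eq_bigr => -[p /= ltp] _; rewrite /f subnKC.
transitivity (\sum_(i < n.+1) \sum_(p < n.+1) \sum_(q < n.+1)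
    (F p * G q) ⊗ (ps_exp A p i * ps_exp A q (n - i)%N)).
  rewrite [RHS]exchange_big; apply: eq_bigr => p _ /=.
  rewrite [RHS]exchange_big; apply: eq_bigr => q _ /=.
  by rewrite /f ps_expD tens_sumr.
apply: eq_bigr => -[i /= lti] _.
rewrite (@residue_widen n) // (@residue_widen n) ?leq_subr // big_distrlr /=.
by apply: eq_bigr => p _; apply: eq_bigr => q _; rewrite tensM.
Qed.

Lemma residue_exp F k : residue (ps_exp F k) A =1 ps_exp (residue F A) k.
Proof.
elim: k => [|k IHk] n; first exact: residue_one.
by rewrite !ps_expS residue_mul; apply: eq_ps_mul.
Qed.

End Residue.

(** * The co-action *)

Section Coaction.
Variable K : comNzRingType.

Lemma Delta_ser_A : Delta_dif \o @ser_A K =1 residue ser_A ser_A.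
Proof. by case=> [|n] /=; rewrite ?linear0 ?residue_AA0 ?Delta_difE. Qed.

(** Delta applied coefficientwise and the substitution of A are both
    multiplicative on power series, and they agree on A by definition of Delta,
    hence on all powers of A. *)
Lemma Delta_ps_exp k n :
  Delta_dif (ps_exp (@ser_A K) k n) = residue (ps_exp ser_A k) ser_A n.
Proof.
have -> : residue (ps_exp ser_A k) ser_A n
    = ps_exp (residue (@ser_A K) ser_A) k n by apply: residue_exp.
have -> : Delta_dif (ps_exp (@ser_A K) k n) = ps_exp (Delta_dif \o ser_A) k n.
  exact: (rmorph_ps_exp Delta_dif).
exact: (eq_ps_exp k Delta_ser_A).
Qed.

Lemma delta_coaction_gen n :
  tens_assoc (tens_map delta_dif idfun (delta_dif (@gen_b K n)))
  = tens_map idfun Delta_dif (delta_dif (gen_b n)).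
Proof.
rewrite delta_difE residueE [tens_map delta_dif _ _]linear_sum.
rewrite [LHS]linear_sum [RHS]linear_sum /=.
transitivity (\sum_(m < n.+1) \sum_(l < n.+1)
    @gen_b K l ⊗ (ps_exp ser_A l m ⊗ ps_exp ser_A m n)).
  apply: eq_bigr => -[m /= ltm] _.
  rewrite tens_mapE /= delta_difE (@residue_widen _ _ _ _ _ n) //.
  rewrite tens_suml linear_sum.
  by apply: eq_bigr => l _; apply: tens_assocE.
rewrite exchange_big; apply: eq_bigr => l _ /=.
by rewrite tens_mapE /= Delta_ps_exp residueE tens_sumr.
Qed.

Lemma delta_coaction (u : Hinv K) :
  tens_assoc (tens_map delta_dif idfun (delta_dif u))
  = tens_map idfun Delta_dif (delta_dif u).
Proof.
apply: (free_ext (f := tens_assoc \o tens_map delta_dif idfun \o delta_dif)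
  (g := tens_map idfun Delta_dif \o delta_dif)) => i /=.
exact: (delta_coaction_gen i.+1).
Qed.

End Coaction.

Unset Implicit Arguments.

Theorem lemma3p2 (R : realType) (u : Hinv R[i]) :
  tens_assoc (tens_map delta_dif idfun (delta_dif u))
  = tens_map idfun Delta_dif (delta_dif u).
Proof. exact: delta_coaction. Qed.
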